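(* For all real $\epsilon$ with $0\leq\epsilon\leq 1$, the capacity of the two-neighbor $k$-constraint with $k=\lceil n^{\epsilon}\rceil$ satisfies $C(\epsilon)=\frac{1+\epsilon}{2}$.
   Context: $S_n$ is the set of all permutations of $\{1,\ldots,n\}$, written $\sigma=[\sigma(1),\ldots,\sigma(n)]$. For positive integers $n,k$, a permutation $\sigma\in S_n$ satisfies the two-neighbor $k$-constraint if for all $i$ with $2\leq i\leq n-1$, either $|\sigma(i-1)-\sigma(i)|\leq k$ or $|\sigma(i)-\sigma(i+1)|\leq k$ (inclusive or). $A_{n,k}$ is the set of all permutations in $S_n$ satisfying the two-neighbor $k$-constraint. For $0\leq\epsilon\leq1$, the capacity is $C(\epsilon)=\limsup_{n\to\infty}\frac{\log|A_{n,k}|}{\log n!}$, where $k=\lceil n^{\epsilon}\rceil$ and logarithms are to base 2. *)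

(* Defs.v *)
From HB Require Import structures.
From mathcomp Require Import all_boot all_order all_algebra all_fingroup.
From mathcomp Require Import all_classical all_reals all_analysis.

Set Implicit Arguments.
Unset Strict Implicit.
Unset Printing Implicit Defensive.

Import Order.TTheory GRing.Theory Num.Theory.
Import numFieldNormedType.Exports.

Local Open Scope ring_scope.

(* 'S_n permutes {0, ..., n-1}: positions and values are both shifted down by
   one with respect to {1, ..., n}, which does not affect the distances. The
   triples (h, i, j) with i = h + 1 and j = i + 1 are exactly the interior
   positions i together with their two neighbors. *)
Definition two_neighbor (n k : nat) (s : 'S_n) : bool :=
  [forall h : 'I_n, forall i : 'I_n, forall j : 'I_n,
     ((i : nat) == h.+1) && ((j : nat) == i.+1) ==>
     ((`|(s h : nat) - (s i : nat)| <= k) || (`|(s i : nat) - (s j : nat)| <= k))%N].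

Definition two_neighbor_perms (n k : nat) : {set 'S_n} :=
  [set s : 'S_n | two_neighbor k s].

Definition log2 {R : realType} (x : R) : R := ln x / ln 2.

Definition ceil_pow {R : realType} (eps : R) (n : nat) : nat :=
  `|Num.ceil (n%:R `^ eps)|%N.

(* For n <= 1 the denominator vanishes and the quotient is 0 by convention;
   this does not affect the limit superior, which is taken in \bar R. *)
Definition capacity {R : realType} (eps : R) : \bar R :=
  limn_esup (fun n : nat =>
    (log2 #|two_neighbor_perms n (ceil_pow eps n)|%:R / log2 (n`!)%:R)%:E).

(* Main.v *)
(* Upper bound: read a permutation two positions at a time. Once s(2j) is known,
   the constraint at 2j+1 leaves at most 2n(2k+1) choices for the pair
   (s(2j+1), s(2j+2)): one of the two steps is short, the other one arbitrary.
   Hence |A_{n,k}| <= n^2 (2n(2k+1))^{n/2}.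

   Lower bound: with h = n/2 and q = (k+1)/2, put 2t(p) at position 2p and
   2g(t(p))+1 at position 2p+1, where t is any permutation of h points and g one
   that moves every point by less than q. Composing such g from permutations of
   consecutive blocks of length q gives at least (q/C)^h of them, so that
   |A_{n,k}| >= (nk)^{n/2} / C^n.

   Both bounds say ln|A_{n,k}| = (1+eps)/2 n ln n + O(n), while
   ln n! = n ln n + O(n). *)
Require Import Defs.
From mathcomp Require Import all_boot all_order all_algebra all_fingroup.
From mathcomp Require Import all_classical all_reals all_analysis.
From mathcomp Require Import zify lra.

Import Order.TTheory GRing.Theory Num.Theory.

(** * Factorials and permutations of bounded displacement *)

Lemma leq_bin_exp2 n m : ('C(n, m) <= 2 ^ n)%N.
Proof.
elim: n m => [|n IHn] [|m]; rewrite ?bin0 ?expn_gt0 //.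
by rewrite binS expnS mul2n -addnn leq_add.
Qed.

(** The falling factorial [(q + r) ^_ r] has [r] factors, each at least [q], and equals [r!] times a
    binomial coefficient. This stands in for Stirling's formula. *)
Lemma leq_exp_fact q r : (q ^ r <= r`! * 2 ^ (q + r))%N.
Proof.
have : (q ^ r <= (q + r) ^_ r)%N.
  rewrite ffact_prod -{1}(card_ord r) -prod_nat_const.
  by apply: leq_prod => i _; have := ltn_ord i; lia.
move=> /leq_trans; apply.
by rewrite -bin_ffact mulnC leq_mul2l leq_bin_exp2 orbT.
Qed.

Definition band_perms (n q : nat) : {set 'S_n} :=
  [set g : 'S_n | [forall p, (`|(g p : nat) - (p : nat)| < q)%N]].

Section PermSum.
Context {a b : nat} (s : 'S_a) (t : 'S_b).

Definition perm_sum_fun (x : 'I_(a + b)) : 'I_(a + b) :=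
  match fintype.split x with
  | inl i => lshift b (s i)
  | inr j => rshift a (t j)
  end.

Lemma perm_sum_funl i : perm_sum_fun (lshift b i) = lshift b (s i).
Proof. by rewrite /perm_sum_fun (unsplitK (inl i)). Qed.

Lemma perm_sum_funr j : perm_sum_fun (rshift a j) = rshift a (t j).
Proof. by rewrite /perm_sum_fun (unsplitK (inr j)). Qed.

Lemma perm_sum_fun_inj : injective perm_sum_fun.
Proof.
move=> x y; rewrite -(splitK x) -(splitK y).
case: (fintype.split x) => i; case: (fintype.split y) => j;
  rewrite /= ?perm_sum_funl ?perm_sum_funr.
- by move=> /lshift_inj/perm_inj ->.
- by move=> /eqP; rewrite eq_lrshift.
- by move=> /eqP; rewrite eq_rlshift.
- by move=> /rshift_inj/perm_inj ->.
Qed.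

Definition perm_sum : 'S_(a + b) := perm perm_sum_fun_inj.

Lemma perm_suml i : perm_sum (lshift b i) = lshift b (s i).
Proof. by rewrite permE perm_sum_funl. Qed.

Lemma perm_sumr j : perm_sum (rshift a j) = rshift a (t j).
Proof. by rewrite permE perm_sum_funr. Qed.

End PermSum.

Lemma perm_sum_inj a b :
  injective (fun st : 'S_a * 'S_b => perm_sum st.1 st.2).
Proof.
move=> [s t] [s' t'] /= E; congr pair; apply/permP => i.
  by apply: (@lshift_inj a b); rewrite -(perm_suml s t) -(perm_suml s' t') E.
by apply: (@rshift_inj a b); rewrite -(perm_sumr s t) -(perm_sumr s' t') E.
Qed.

(** In a block of length at most [q] every displacement is below [q], and shifting the second block
    preserves its displacements. *)
Lemma band_perms_add a b q : (a <= q)%N ->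
  (a`! * #|band_perms b q| <= #|band_perms (a + b) q|)%N.
Proof.
move=> aq; rewrite -card_Sn -cardsT -cardsX.
rewrite -(card_imset _ (@perm_sum_inj a b)).
apply/subset_leq_card/fintype.subsetP => _ /imsetP[[s t] /setXP[_ tb] ->] /=.
move: tb; rewrite !inE => /forallP tb; apply/forallP => x.
rewrite -(splitK x); case: (fintype.split x) => i /=.
  by rewrite perm_suml /=; have := ltn_ord i; have := ltn_ord (s i); lia.
by rewrite perm_sumr /=; have := tb i; lia.
Qed.

(** Blocks of length [q] are split off one by one, each costing a factor [4 ^ q]. The last, shorter
    block is responsible for the single factor [2 ^ q]. *)
Lemma leq_exp_band_perms n q : (0 < q)%N ->
  (q ^ n <= #|band_perms n q| * 4 ^ n * 2 ^ q)%N.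
Proof.
move=> q0; elim/ltn_ind: n => n IHn.
have pow4 m : (4 ^ m = 2 ^ m * 2 ^ m)%N by rewrite -expnMn.
have [nq|qn] := leqP n q.
  have -> : #|band_perms n q| = n`!.
    rewrite -card_Sn; apply/eq_card => g; rewrite !inE; apply/forallP => p.
    by have := ltn_ord p; have := ltn_ord (g p); lia.
  apply: leq_trans (leq_exp_fact q n) _.
  rewrite pow4 expnD -!mulnA leq_mul2l; apply/orP; right.
  rewrite mulnC leq_mul2l; apply/orP; right.
  by rewrite -{1}[(2 ^ q)%N]mul1n leq_mul2r expn_gt0 orbT.
have := IHn (n - q)%N; rewrite ltn_subrL q0 (ltn_trans q0 qn) => /(_ isT) IH.
have E : n = (q + (n - q))%N by lia.
rewrite {1}E expnD; apply: leq_trans (leq_mul (leq_exp_fact q q) IH) _.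
have := @band_perms_add q (n - q) q (leqnn q); rewrite -E => H.
rewrite [in X in (_ <= X)%N]E [in X in (_ <= X)%N]expnD -E.
rewrite (expnD 2) -pow4.
set x := q`! in H *; set G := #|_| in H *; set G' := #|_| in H *.
set u := (4 ^ q)%N; set v := (4 ^ (n - q))%N; set w := (2 ^ q)%N.
rewrite (_ : (_ * _ = x * G * (u * v * w))%N); last by lia.
by rewrite -(mulnA G') leq_mul.
Qed.

(** * Interleaving two permutations on even and odd positions *)

Definition perm_ext {h : nat} (t : 'S_h) (p : nat) : nat :=
  if insub p is Some i then t i else p.

Lemma perm_ext_ord h (t : 'S_h) (i : 'I_h) : perm_ext t i = t i.
Proof. by rewrite /perm_ext valK. Qed.

Section Interleave.
Context {h : nat} (t u : 'S_h).

(** The default value of [perm_ext] is never reached here, since [x./2 < h]. Fixing the points from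
    [h.*2] on takes care of the last position when [n] is odd. *)
Definition interleave_nat (x : nat) : nat :=
  if (x < h.*2)%N then
    if odd x then (perm_ext u x./2).*2.+1 else (perm_ext t x./2).*2
  else x.

Lemma interleave_even (p : 'I_h) : interleave_nat p.*2 = (t p).*2.
Proof.
by rewrite /interleave_nat ltn_double ltn_ord odd_double doubleK perm_ext_ord.
Qed.

Lemma interleave_odd (p : 'I_h) : interleave_nat p.*2.+1 = (u p).*2.+1.
Proof.
rewrite /interleave_nat ltn_Sdouble ltn_ord oddS odd_double.
by rewrite /= uphalf_double perm_ext_ord.
Qed.

Lemma interleave_ge x : (h.*2 <= x)%N -> interleave_nat x = x.
Proof. by rewrite /interleave_nat ltnNge => ->. Qed.

Variant interleave_spec (x : nat) : Prop :=
| InterleaveEven (p : 'I_h) of x = p.*2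
| InterleaveOdd (p : 'I_h) of x = p.*2.+1
| InterleaveGe of (h.*2 <= x)%N.

Lemma interleaveP x : interleave_spec x.
Proof.
have [hx|xh] := leqP h.*2 x; first exact: InterleaveGe.
have xh2 : (x./2 < h)%N by lia.
case o : (odd x).
  by apply: (@InterleaveOdd _ (Ordinal xh2)) => /=; lia.
by apply: (@InterleaveEven _ (Ordinal xh2)) => /=; lia.
Qed.

Lemma interleave_nat_inj : injective interleave_nat.
Proof.
move=> x y.
case: (interleaveP x) => [p ->|p ->|hx]; case: (interleaveP y) => [r ->|r ->|hy];
  rewrite ?interleave_even ?interleave_odd ?interleave_ge //.
- by move=> /double_inj/val_inj/perm_inj ->.
- by lia.
- by have := ltn_ord (t p); lia.
- by lia.
- by move=> /succn_inj/double_inj/val_inj/perm_inj ->.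
- by have := ltn_ord (u p); lia.
- by have := ltn_ord (t r); lia.
- by have := ltn_ord (u r); lia.
Qed.

Lemma interleave_nat_ltn n x : (h.*2 <= n)%N -> (x < n)%N ->
  (interleave_nat x < n)%N.
Proof.
move=> hn; case: (interleaveP x) => [p ->|p ->|hx];
  rewrite ?interleave_even ?interleave_odd ?interleave_ge //.
- by have := ltn_ord (t p); lia.
- by have := ltn_ord (u p); lia.
Qed.

Context {n : nat} (hn : (h.*2 <= n)%N).

Definition interleave_fun (x : 'I_n) : 'I_n :=
  Ordinal (interleave_nat_ltn _ _ hn (ltn_ord x)).

Lemma interleave_fun_inj : injective interleave_fun.
Proof. by move=> x y [] /interleave_nat_inj/val_inj. Qed.

Definition interleave : 'S_n := perm interleave_fun_inj.

Lemma interleaveE (x : 'I_n) : interleave x = interleave_nat x :> nat.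
Proof. by rewrite permE. Qed.

End Interleave.

Lemma interleave_inj h n (hn : (h.*2 <= n)%N) :
  injective (fun tu : 'S_h * 'S_h => interleave tu.1 tu.2 hn).
Proof.
move=> [t u] [t' u'] /= E.
have {}E x : (x < n)%N -> interleave_nat t u x = interleave_nat t' u' x.
  by move=> xn; rewrite -!(interleaveE _ _ hn (Ordinal xn)) E.
congr pair; apply/permP => p; apply/val_inj/double_inj.
  rewrite -(interleave_even t u) -(interleave_even t' u') E //.
  by have := ltn_ord p; lia.
apply: succn_inj; rewrite -(interleave_odd t u) -(interleave_odd t' u') E //.
by have := ltn_ord p; lia.
Qed.

(** The values at positions [2p] and [2p + 1] differ by at most [2(q - 1) + 1 <= k], and any three
    consecutive positions contain such a pair. *)
Lemma interleave_two_neighbor n k q (t g : 'S_(n./2)) (hn : (n./2.*2 <= n)%N) :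
  (q.*2 <= k.+1)%N -> g \in band_perms n./2 q ->
  two_neighbor k (interleave t (t * g)%g hn).
Proof.
rewrite inE => qk /forallP gb.
apply/forallP => a; apply/forallP => i; apply/forallP => j.
apply/implyP => /andP[/eqP ia /eqP ji]; rewrite !interleaveE ji ia.
(* The parity of the first position decides which of the two steps lies inside a pair. *)
case o : (odd a).
  have p2 : (a.+1./2 < n./2)%N by have := ltn_ord j; lia.
  set p := Ordinal p2; have -> : (nat_of_ord a).+1 = p.*2 by rewrite /=; lia.
  rewrite interleave_even interleave_odd permM.
  by apply/orP; right; have := gb (t p); lia.
have p2 : (a./2 < n./2)%N by have := ltn_ord j; lia.
set p := Ordinal p2; have -> : nat_of_ord a = p.*2 by rewrite /=; lia.
rewrite interleave_even interleave_odd permM.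
by apply/orP; left; have := gb (t p); lia.
Qed.

(** The interleaving determines [t] and [t * g], hence also [g] by cancellation. *)
Lemma leq_fact_band_perms n k q : (q.*2 <= k.+1)%N ->
  (n./2`! * #|band_perms n./2 q| <= #|two_neighbor_perms n k|)%N.
Proof.
move=> qk; have hn : (n./2.*2 <= n)%N by lia.
rewrite -card_Sn -cardsT -cardsX.
have inj : injective (fun tg : 'S_n./2 * 'S_n./2 =>
    interleave tg.1 (tg.1 * tg.2)%g hn).
  move=> [t g] [t' g'] /= /(@interleave_inj _ _ hn (_, _) (_, _)) [<-].
  by move=> /mulgI ->.
rewrite -(card_imset _ inj).
apply/subset_leq_card/fintype.subsetP => _ /imsetP[[t g] /setXP[_ gb] ->].
by rewrite inE; exact: interleave_two_neighbor gb.
Qed.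

(** * Encoding a constrained permutation two positions at a time *)

Section PairCode.
Context {n k : nat}.

(* The coded difference is shifted by [k], so for a short step the truncated
   subtraction is exact and the value fits in ['I_(k.*2.+1)]. *)
Definition pair_code (s : 'S_n.+1) (j : nat) : bool * 'I_n.+1 * 'I_(k.*2.+1) :=
  let a := s (inord j.*2) in
  let b := s (inord j.*2.+1) in
  let c := s (inord j.*2.+2) in
  if (`|(a : nat) - (b : nat)| <= k)%N then (true, c, inord (b + k - a))
  else (false, b, inord (c + k - b)).

(** The flag tells which step is short. If it is the first, [b] is recovered from its offset to the
    known [a]; otherwise the constraint makes the second step short, and [c] is recovered from its
    offset to the stored [b]. *)
Lemma pair_code_inj (s t : 'S_n.+1) j :
    s \in two_neighbor_perms n.+1 k -> t \in two_neighbor_perms n.+1 k ->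
    (j < n./2)%N -> s (inord j.*2) = t (inord j.*2) ->
    pair_code s j = pair_code t j ->
  s (inord j.*2.+1) = t (inord j.*2.+1) /\
  s (inord j.*2.+2) = t (inord j.*2.+2).
Proof.
move=> sA tA jn.
have close (u : 'S_n.+1) : u \in two_neighbor_perms n.+1 k ->
    (`|(u (inord j.*2) : nat) - (u (inord j.*2.+1) : nat)| <= k)%N ||
    (`|(u (inord j.*2.+1) : nat) - (u (inord j.*2.+2) : nat)| <= k)%N.
  rewrite inE => /forallP/(_ (inord j.*2))/forallP/(_ (inord j.*2.+1)).
  by move=> /forallP/(_ (inord j.*2.+2))/implyP; apply; rewrite !inordK; lia.
move: (close s sA) (close t tA); rewrite /pair_code => + + E; rewrite -E.
set a := s _; set b := s _; set c := s _; set b' := t _; set c' := t _.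
have eq_of_code (x y z : 'I_n.+1) :
    (`|(x : nat) - (y : nat)| <= k)%N -> (`|(x : nat) - (z : nat)| <= k)%N ->
    inord (y + k - x) = inord (z + k - x) :> 'I_(k.*2.+1) -> y = z.
  move=> xy xz /(congr1 val) /=; rewrite !inordK; [|lia|lia].
  by move=> e; apply: val_inj => /=; lia.
case: ifP => [ab _|_ /= bc]; case: ifP => [ab' _|_ /= bc'] // [].
  by move=> -> /(eq_of_code _ _ _ ab ab').
by move=> eb; rewrite -eb in bc' *; move=> /(eq_of_code _ _ _ bc bc').
Qed.

Definition perm_code (s : 'S_n.+1) :
    {ffun 'I_(n./2) -> bool * 'I_n.+1 * 'I_(k.*2.+1)} * 'I_n.+1 * 'I_n.+1 :=
  ([ffun j : 'I_(n./2) => pair_code s j], s ord0, s ord_max).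

(* [s ord_max] is only needed for even [n.+1], when the last position is not
   covered by a pair. *)
Lemma perm_code_inj : {in two_neighbor_perms n.+1 k &, injective perm_code}.
Proof.
move=> s t sA tA [/ffunP E e0 eM].
(* Decoding starts from [s ord0]; each pair ends at the even position from which the next one is
   decoded. *)
have even j : (j <= n./2)%N -> s (inord j.*2) = t (inord j.*2).
  elim: j => [_|j IHj jn].
    by rewrite (_ : inord 0.*2 = ord0) //; apply: val_inj; rewrite /= inordK.
  have := E (Ordinal jn); rewrite !ffunE /=.
  by case/(pair_code_inj _ _ _ sA tA jn (IHj (ltnW jn))).
apply/permP => x; rewrite -(inord_val x).
have xn := ltn_ord x.
have [/eqP|nx] := boolP (val x == n).
  move=> /= ->; suff -> : inord n = ord_max :> 'I_n.+1 by [].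
  by apply: val_inj; rewrite /= inordK.
rewrite -[nat_of_ord x]odd_double_half; case o : (odd x).
  have jn : (x./2 < n./2)%N by move: nx => /= nx; lia.
  have := E (Ordinal jn); rewrite !ffunE /=.
  by case/(pair_code_inj _ _ _ sA tA jn (even _ (ltnW jn))).
by rewrite add0n; apply: even; lia.
Qed.

End PairCode.

(** * Both counting bounds in terms of [n * k] *)

Lemma leq_card_two_neighbor n k :
  (#|two_neighbor_perms n.+1 k| <=
    (2 * n.+1 * k.*2.+1) ^ n./2 * n.+1 * n.+1)%N.
Proof.
have := leq_card_in (@perm_code n k) _ perm_code_inj.
by rewrite !card_prod card_ffun !card_prod card_bool !card_ord.
Qed.

Lemma two_neighbor_perms_le n k : (0 < n)%N -> (0 < k)%N ->
  (#|two_neighbor_perms n k| <= (6 * (n * k)) ^ n./2 * (n * n))%N.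
Proof.
case: n => // n _ k0; apply: leq_trans (leq_card_two_neighbor n k) _.
rewrite -mulnA leq_mul2r; apply/orP; right.
(* The constant comes from [2(2k + 1) <= 6k] for positive [k]. *)
apply: (@leq_trans ((6 * (n.+1 * k)) ^ n./2)).
  by case: (posnP n./2) => [->//|h0]; rewrite leq_exp2r //; nia.
by rewrite leq_pexp2l ?half_leq //; lia.
Qed.

Lemma two_neighbor_perms_ge n k : (1 < n)%N -> (0 < k)%N -> (k <= n)%N ->
  ((n * k) ^ n./2 <= #|two_neighbor_perms n k| * 64 ^ n)%N.
Proof.
move=> n1 k0 kn; set h := n./2; set q := k.+1./2.
have qk : (q.*2 <= k.+1)%N by rewrite /q; lia.
have q0 : (0 < q)%N by rewrite /q; lia.
have h0 : (0 < h)%N by rewrite /h; lia.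
have A := @leq_fact_band_perms n k q qk.
have H := leq_exp_fact h h.
have G := @leq_exp_band_perms h q q0.
have nk : (n * k <= 8 * (h * q))%N.
  have : (n <= 3 * h)%N by rewrite /h; lia.
  have : (k <= 2 * q)%N by rewrite /q; lia.
  by nia.
apply: (@leq_trans ((8 * (h * q)) ^ h)); first by rewrite leq_exp2r.
rewrite !expnMn; apply: leq_trans (leq_mul (leqnn _) (leq_mul H G)) _.
(* All losses are powers of 2 with total exponent [7h + q], which is at most [6n] because
   [k <= n]. *)
rewrite (_ : 4 = 2 ^ 2)%N // (_ : 8 = 2 ^ 3)%N // (_ : 64 = 2 ^ 6)%N // -!expnM.
rewrite -(mulnA #|_|) mulnACA mulnCA.
apply: leq_mul => //; rewrite -!expnD leq_exp2l //.
by rewrite /h /q; lia.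
Qed.

Local Open Scope ring_scope.

(** * Logarithmic estimates with linear error terms *)

Section RealEstimates.
Context {R : realType}.
Implicit Types (m n : nat) (eps : R).

Lemma ln_natM m n : (0 < m)%N -> (0 < n)%N ->
  ln (m * n)%:R = ln m%:R + ln n%:R :> R.
Proof. by move=> m0 n0; rewrite natrM lnM ?posrE ?ltr0n. Qed.

Lemma ln_natX m n : (0 < m)%N -> ln (m ^ n)%:R = n%:R * ln m%:R :> R.
Proof. by move=> m0; rewrite natrX lnXn ?ltr0n // mulr_natl. Qed.

Lemma ler_ln_nat m n : (0 < m)%N -> (m <= n)%N -> ln m%:R <= ln n%:R :> R.
Proof.
move=> m0 mn; rewrite ler_ln ?posrE ?ltr0n ?ler_nat //.
exact: leq_trans mn.
Qed.

Lemma ln_nat_ge0 n : 0 <= ln n%:R :> R.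
Proof.
by case: n => [|n]; [rewrite ln0|rewrite ln_ge0 // ler1n].
Qed.

Lemma ln_le_subr1 (x : R) : 0 < x -> ln x <= x - 1.
Proof.
by move=> x0; rewrite -{1}(subrKC 1 x) le_ln1Dx //; lra.
Qed.

Lemma ln_fact_bounds n : (0 < n)%N ->
  n%:R * ln n%:R - 2 * n%:R <= ln (n`!%:R : R) <= n%:R * ln n%:R.
Proof.
move=> n0; apply/andP; split; last first.
  rewrite -ln_natX // ler_ln_nat ?fact_gt0 // -ffactnn ffact_prod.
  rewrite -[X in (_ <= _ ^ X)%N]card_ord -prod_nat_const.
  by apply: leq_prod => i _; exact: leq_subr.
have := @ler_ln_nat _ _ _ (leq_exp_fact n n); rewrite expn_gt0 n0 => /(_ isT).
rewrite ln_natM ?fact_gt0 ?expn_gt0 // !ln_natX // natrD.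
have l2 : ln 2 <= 2 - 1 :> R by exact: ln_le_subr1.
have n0' : 0 <= n%:R :> R by [].
by nra.
Qed.

Lemma ceil_pow_bounds eps n : 0 <= eps -> eps <= 1 -> (0 < n)%N ->
  [/\ (0 < ceil_pow eps n)%N, (ceil_pow eps n <= n)%N,
      eps * ln n%:R <= ln (ceil_pow eps n)%:R &
      ln (ceil_pow eps n)%:R <= 1 + eps * ln n%:R].
Proof.
move=> e0 e1 n0; have n1 : 1 <= n%:R :> R by rewrite ler1n.
set x : R := n%:R `^ eps.
have x1 : 1 <= x by rewrite -(powRr0 n%:R) ler_powR.
have xn : x <= n%:R by rewrite -[leRHS]powRr1 // ler_powR.
have lnx : ln x = eps * ln n%:R by rewrite ln_powR.
have c0 : (0 <= Num.ceil x)%R by rewrite Num.Theory.ceil_ge0; lra.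
have kE : (ceil_pow eps n)%:R = (Num.ceil x)%:~R :> R.
  by rewrite /ceil_pow -/x natr_absz ger0_norm.
have /andP[kx xk] := Num.Theory.ceil_itv x; rewrite intrB -kE in kx.
rewrite -kE in xk.
have k0 : 0 < (ceil_pow eps n)%:R :> R by lra.
split.
- by rewrite -(ltr0n R).
- rewrite -(ler_nat R) kE -[n%:R]/(n%:Z%:~R) ler_int Num.Theory.ceil_le_int.
  exact: xn.
- by rewrite -lnx ler_ln ?posrE //; lra.
(* Since [1 <= x], the ceiling is below [x + 1 <= 2 * x], so rounding costs at most [ln 2 <= 1]. *)
- have : ln (ceil_pow eps n)%:R <= ln (2 * x).
    by rewrite ler_ln ?posrE //; lra.
  have l2 : ln 2 <= 2 - 1 :> R by exact: ln_le_subr1.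
  by rewrite lnM ?posrE -?lnx; lra.
Qed.

Lemma ln_two_neighbor_perms eps n : 0 <= eps -> eps <= 1 -> (1 < n)%N ->
  `|ln #|two_neighbor_perms n (ceil_pow eps n)|%:R
    - (1 + eps) / 2 * (n%:R * ln n%:R)| <= 7 * n%:R.
Proof.
move=> e0 e1 n1; have n0 := ltnW n1.
have [k0 kn klo kup] := ceil_pow_bounds _ _ e0 e1 n0.
have up := two_neighbor_perms_le _ _ n0 k0.
have lo := two_neighbor_perms_ge _ _ n1 k0 kn.
set k := ceil_pow eps n in k0 kn klo kup up lo *.
set A := #|_| in up lo *.
have A0 : (0 < A)%N.
  have : (0 < A * 64 ^ n)%N.
    by apply: leq_trans lo; rewrite expn_gt0 muln_gt0 n0 k0.
  by rewrite muln_gt0 => /andP[].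
have nk0 : (0 < n * k)%N by rewrite muln_gt0 n0.
move: (ler_ln_nat _ _ A0 up) => {}up.
have {}lo := @ler_ln_nat _ _ _ lo; rewrite expn_gt0 nk0 in lo; have {}lo := lo isT.
move: up lo; rewrite !(ln_natM, ln_natX) ?expn_gt0 ?muln_gt0 ?n0 ?k0 //.
rewrite (_ : 64 = 2 ^ 6)%N // ln_natX //.
have -> : ln 6%:R = ln 2 + ln 3 :> R by rewrite -(@ln_natM 2 3).
have l2 : ln 2 <= 2 - 1 :> R by exact: ln_le_subr1.
have l3 : ln 3 <= 3 - 1 :> R by exact: ln_le_subr1.
have l20 : 0 <= ln 2 :> R by exact: (ln_nat_ge0 2).
have l30 : 0 <= ln 3 :> R by exact: (ln_nat_ge0 3).
have ln0 : 0 <= ln n%:R :> R by exact: ln_nat_ge0.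
have lnn : ln n%:R <= n%:R - 1 :> R by apply: ln_le_subr1; rewrite ltr0n.
have hlo : n%:R - 1 <= 2 * (n./2)%:R :> R.
  by rewrite lerBlDr -natrM natr1 ler_nat; lia.
have hup : 2 * (n./2)%:R <= n%:R :> R by rewrite -natrM ler_nat; lia.
set L := ln n%:R in ln0 lnn klo kup *; set K := ln k%:R in klo kup *.
set h : R := (n./2)%:R in hlo hup *; set N : R := n%:R in lnn hlo hup *.
have N2 : 2 <= N by rewrite ler_nat.
move=> up lo; rewrite ler_norml; apply/andP; split.
  (* Lower bound: the factor [64 ^ n] costs at most [6 * N], and replacing [h] by [N / 2] at most
     [L <= N], which gives the constant 7. *)
  have : h * (L + eps * L) <= h * (L + K) by apply: ler_wpM2l; lra.
  have : (N - 1) / 2 * ((1 + eps) * L) <= h * ((1 + eps) * L).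
    by apply: ler_wpM2r; [apply: mulr_ge0|]; lra.
  have : eps * L <= L by rewrite -[leRHS]mul1r ler_wpM2r.
  by nra.
(* Upper bound: the 4 is 3 for [ln 6] plus 1 for the ceiling; the factor [n * n] adds
   [2 * L <= 2 * N]. *)
have : h * (ln 2 + ln 3 + (L + K)) <= h * (4 + (1 + eps) * L).
  by apply: ler_wpM2l; lra.
have : h * (4 + (1 + eps) * L) <= N / 2 * (4 + (1 + eps) * L).
  by apply: ler_wpM2r; [apply: addr_ge0; [|apply: mulr_ge0]|]; lra.
by nra.
Qed.

Lemma capacity_ratio_bound eps n : 0 <= eps -> eps <= 1 -> (1 < n)%N ->
    2 < ln n%:R :> R ->
  `|log2 #|two_neighbor_perms n (ceil_pow eps n)|%:R / log2 n`!%:R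
    - (1 + eps) / 2| <= 9 / (ln n%:R - 2).
Proof.
move=> e0 e1 n1 L2; have n0 := ltnW n1.
have A := ln_two_neighbor_perms _ _ e0 e1 n1.
have /andP[flo fup] := ln_fact_bounds _ n0.
have N0 : 0 < n%:R :> R by rewrite ltr0n.
have ln2 : 0 < ln 2 :> R by rewrite ln_gt0 // ltr1n.
rewrite /log2 invf_div mulrA divfK ?gt_eqF //.
set a := ln _ in A *; set f := ln n`!%:R in flo fup *; set L := ln n%:R in A L2 flo fup *.
set N : R := n%:R in A flo fup N0 *.
have NL : 0 < N * (L - 2) by apply: mulr_gt0; lra.
have f0 : 0 < f by lra.
have -> : a / f - (1 + eps) / 2 = (a - (1 + eps) / 2 * f) / f.
  by rewrite mulrBl mulfK ?gt_eqF.
rewrite normrM normfV (gtr0_norm f0) ler_pdivrMr //.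
(* The 9 is 7 from the count plus 2 from [ln n!], whose coefficient [(1 + eps) / 2] is at most 1;
   also [f >= N * (L - 2)]. *)
apply: (@le_trans _ _ (9 * N)); last first.
  by rewrite mulrAC ler_pdivlMr; nra.
move: A; rewrite !ler_norml => /andP[alo aup].
by apply/andP; split; nra.
Qed.

End RealEstimates.

(** * Passage to the limit *)

Theorem corollary1 (R : realType) (eps : R) (heps0 : 0 <= eps)
    (heps1 : eps <= 1) :
  capacity eps = ((1 + eps) / 2)%:E.
Proof.
apply: (cvg_limn_einf_sup _).2.
apply/fine_cvgP; split; first by near=> n.
apply/cvgrPdist_le => /= e e0; near=> n.
rewrite distrC.
(* This threshold is exactly what makes [9 / (ln n - 2)] at most [e]. *)
have L : 2 + 9 / e <= ln n%:R.
  rewrite -[leLHS]expRK ler_ln ?posrE ?expR_gt0 //.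
    by near: n; exact: nbhs_infty_ger.
  by rewrite ltr0n; near: n; exact: nbhs_infty_gt.
have e9 : 0 < 9 / e by rewrite divr_gt0.
apply: le_trans (capacity_ratio_bound _ _ heps0 heps1 _ _) _.
- by near: n; exact: nbhs_infty_gt.
- by lra.
- rewrite ler_pdivrMr; last by lra.
  by rewrite mulrC -ler_pdivrMr //; lra.
Unshelve. all: by end_near.
Qed.
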